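(* Let $A\in\mathbb{R}^{n\times d}$, $b\in\mathbb{R}^n$, and let $k\ge 1$ satisfy $k\le \mathrm{rank}(A)$ and $\sigma_k>\sigma_{k+1}$, where $\sigma_i=\sigma_i(A)$. Suppose that $R\in\mathbb{R}^{d\times s}$ where $s\ge k$. Assume that $\nu\in(0,1)$. 1. If $d_2(U_{AR,k},U_{A,k})\le \nu$, then $A x_{R,k}$ is a $(\nu,\nu)$-approximate PCP of rank $k$. 2. If $s=k$, $R$ has orthonormal columns (i.e. $R^{T}R=I_k$), and $d_2(R,V_{A,k})\le \nu(1+\nu^2)^{-1/2}$, then $x_R$ is a $$\left(\frac{\sigma_{k+1}}{\sigma_k}\nu,\ \frac{\nu}{\left(\sqrt{1-\nu^2}-\nu\right)\sigma_k}\right)\text{-approximate PCR of rank }k.$$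
   Context: $\|\cdot\|_2$ is the Euclidean norm of vectors and the spectral norm of matrices. For $X\in\mathbb{R}^{m\times n}$, $X=U_X\Sigma_X V_X^{T}$ denotes a thin SVD ($U_X\in\mathbb{R}^{m\times\min(m,n)}$ and $V_X\in\mathbb{R}^{n\times\min(m,n)}$ with orthonormal columns, $\Sigma_X$ diagonal with the singular values $\sigma_1(X)\ge\dots\ge\sigma_{\min(m,n)}(X)\ge 0$). $U_{X,k},V_{X,k}$ are the first $k$ columns of $U_X,V_X$, and $U_{X,k+},V_{X,k+}$ the last $\min(m,n)-k$ columns. Thin SVDs need not be unique; statements are meant for any such decomposition. We read $\sigma_{k+1}(X)=0$ if $k=\min(m,n)$. $X^{+}$ is the Moore–Penrose pseudo-inverse. For matrices $U,W$ with the same number of rows, $d_2(U,W)=\|P_U-P_W\|_2$, where $P_X$ is the orthogonal projection onto the column space of $X$. The rank-$k$ principal component regression (PCR) solution is $x_k=\arg\min_{x\in\mathrm{range}(V_{A,k})}\|Ax-b\|_2$, and the principal component projection (PCP) of $b$ is $b_k=Ax_k$. For $R\in\mathbb{R}^{d\times s}$, $x_{R,k}=R V_{AR,k}(A R V_{AR,k})^{+}b$; when $R$ has exactly $k$ columns this equals $x_R=R(AR)^{+}b$. A vector $\tilde x\in\mathbb{R}^d$ is an $(\epsilon,\upsilon)$-approximate PCR of rank $k$ if $\big|\,\|A\tilde x-b\|_2-\|Ax_k-b\|_2\big|\le\epsilon\|b\|_2$ and $\|V_{A,k+}^{T}\tilde x\|_2\le\upsilon\|b\|_2$. A vector $\tilde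 b\in\mathbb{R}^n$ is an $(\epsilon,\upsilon)$-approximate PCP of rank $k$ if $\big|\,\|\tilde b-b\|_2-\|b_k-b\|_2\big|\le\epsilon\|b\|_2$ and $\|U_{A,k+}^{T}\tilde b\|_2\le\upsilon\|b\|_2$.
   Formalization: Part 1 additionally assumes rank(AR) ≥ k (it fails for A=1, R=0, b=1); in part 2 the second bound is asserted only when √(1−ν²) > ν, since otherwise it is negative or undefined, while the residual bound is kept for all ν in (0,1). *)

(* Defs.v *)
From HB Require Import structures.
From mathcomp Require Import all_boot all_order all_algebra.
From mathcomp Require Import classical_sets reals.

Set Implicit Arguments.
Unset Strict Implicit.
Unset Printing Implicit Defensive.

Import Order.TTheory GRing.Theory Num.Theory.
Local Open Scope classical_set_scope.
Local Open Scope ring_scope.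

(* The norm that MathComp-Analysis puts on matrices is the max norm, hence the
   explicit Euclidean and spectral norms. *)
Definition l2norm (F : realType) (n : nat) (x : 'cV[F]_n) : F :=
  Num.sqrt (\sum_i x i 0 ^+ 2).

Definition specnorm (F : realType) (m n : nat) (M : 'M[F]_(m, n)) : F :=
  sup [set l2norm (M *m x) | x in [set x : 'cV[F]_n | l2norm x <= 1]].

(* [S] is the row of diagonal entries of Sigma, in nonincreasing order. *)
Definition is_thin_svd (F : realType) (m n : nat) (X : 'M[F]_(m, n))
    (U : 'M[F]_(m, minn m n)) (S : 'rV[F]_(minn m n))
    (V : 'M[F]_(n, minn m n)) : Prop :=
  [/\ U^T *m U = 1%:M,
      V^T *m V = 1%:M,
      X = U *m diag_mx S *m V^T,
      (forall i j : 'I_(minn m n), (i <= j)%N -> S 0 j <= S 0 i) &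
      (forall i, 0 <= S 0 i)].

(* One-based: [sigma S i] is the i-th entry of [S] for 1 <= i <= r, and 0 for
   i > r. *)
Definition sigma (F : realType) (r : nat) (S : 'rV[F]_r) (i : nat) : F :=
  oapp (S 0) 0 (insub i.-1).

(* The padding value 0 is reached only when r < k. *)
Definition first_cols (F : realType) (m r : nat) (k : nat) (M : 'M[F]_(m, r)) :
    'M[F]_(m, k) :=
  \matrix_(i < m, j < k) oapp (M i) 0 (insub (j : nat)).

(* Here [k + j < r] always holds, so the padding value is never reached. *)
Definition last_cols (F : realType) (m r : nat) (k : nat) (M : 'M[F]_(m, r)) :
    'M[F]_(m, r - k) :=
  \matrix_(i < m, j < r - k) oapp (M i) 0 (insub (k + j)%N).

(* The four Penrose equations, over the reals. *)
Definition is_mp_inverse (F : realType) (m n : nat) (X : 'M[F]_(m, n))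
    (Y : 'M[F]_(n, m)) : Prop :=
  [/\ X *m Y *m X = X,
      Y *m X *m Y = Y,
      (X *m Y)^T = X *m Y &
      (Y *m X)^T = Y *m X].

(* The library's [pinvmx] is only a partial inverse, not the Moore-Penrose
   one. *)
Definition mp_inverse (F : realType) (m n : nat) (X : 'M[F]_(m, n)) :
    'M[F]_(n, m) :=
  xget 0 [set Y | is_mp_inverse X Y].

(* MathComp matrices act on row vectors: the row space of [X^T] is the column
   space of [X], [kermx X] spans its orthogonal complement, and [proj_mx]
   projects onto the former along the latter; transposing makes it act on
   column vectors. *)
Definition col_proj (F : realType) (m p : nat) (X : 'M[F]_(m, p)) : 'M[F]_m :=
  (proj_mx (<<X^T>>%MS) (kermx X))^T.

Definition d2 (F : realType) (m p q : nat) (U : 'M[F]_(m, p))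
    (W : 'M[F]_(m, q)) : F :=
  specnorm (col_proj U - col_proj W).

Definition is_pcr (F : realType) (n d r : nat) (A : 'M[F]_(n, d))
    (V : 'M[F]_(d, r)) (b : 'cV[F]_n) (k : nat) (x : 'cV[F]_d) : Prop :=
  (exists y : 'cV[F]_k, x = first_cols k V *m y) /\
  (forall y : 'cV[F]_k,
     l2norm (A *m x - b) <= l2norm (A *m (first_cols k V *m y) - b)).

(* [V] stands for V_A.  The minimizer is unique when sigma_k(A) > 0. *)
Definition pcr (F : realType) (n d r : nat) (A : 'M[F]_(n, d))
    (V : 'M[F]_(d, r)) (b : 'cV[F]_n) (k : nat) : 'cV[F]_d :=
  xget 0 [set x | is_pcr A V b k x].

Definition pcp (F : realType) (n d r : nat) (A : 'M[F]_(n, d))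
    (V : 'M[F]_(d, r)) (b : 'cV[F]_n) (k : nat) : 'cV[F]_n :=
  A *m pcr A V b k.

(* [V'] stands for V_{AR}. *)
Definition sketched_pcr (F : realType) (n d s r : nat) (A : 'M[F]_(n, d))
    (R : 'M[F]_(d, s)) (V' : 'M[F]_(s, r)) (b : 'cV[F]_n) (k : nat) :
    'cV[F]_d :=
  R *m first_cols k V' *m mp_inverse (A *m R *m first_cols k V') *m b.

Definition sketched_ls (F : realType) (n d s : nat) (A : 'M[F]_(n, d))
    (R : 'M[F]_(d, s)) (b : 'cV[F]_n) : 'cV[F]_d :=
  R *m mp_inverse (A *m R) *m b.

Definition approx_pcr (F : realType) (n d r : nat) (A : 'M[F]_(n, d))
    (V : 'M[F]_(d, r)) (b : 'cV[F]_n) (k : nat) (eps ups : F)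
    (x : 'cV[F]_d) : Prop :=
  `|l2norm (A *m x - b) - l2norm (A *m pcr A V b k - b)| <= eps * l2norm b /\
  l2norm ((last_cols k V)^T *m x) <= ups * l2norm b.

Definition approx_pcp (F : realType) (n d r : nat) (A : 'M[F]_(n, d))
    (U : 'M[F]_(n, r)) (V : 'M[F]_(d, r)) (b : 'cV[F]_n) (k : nat)
    (eps ups : F) (b' : 'cV[F]_n) : Prop :=
  `|l2norm (b' - b) - l2norm (pcp A V b k - b)| <= eps * l2norm b /\
  l2norm ((last_cols k U)^T *m b') <= ups * l2norm b.

(* Main.v *)
Require Import Defs.
From HB Require Import structures.
From mathcomp Require Import all_boot all_order all_algebra.
From mathcomp Require Import classical_sets reals.
From mathcomp Require Import ring lra.

Set Implicit Arguments.
Unset Strict Implicit.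
Unset Printing Implicit Defensive.

Import Order.TTheory GRing.Theory Num.Theory.
Local Open Scope ring_scope.

(** Write sigma_i for the singular values of A, Q for the orthogonal projection
    onto the span of the first k left singular vectors of A, Pi for the one
    onto the span of the first k right singular vectors, and P for the
    projection A R (A R)^+ in the second part, and for the projection onto the
    span of the first k left singular vectors of A R in the first part.  Both sketched
    solutions x satisfy A x = P b, and the residual of the exact PCR solution
    is Q b - b ([pcr_residual]).  The two residual norms therefore differ by at
    most |(P - Q) b|, and the theorem comes down to bounds on P - Q.

    In the first part |(P - Q) b| <= nu |b| is the hypothesis, and the trailing
    left singular vectors annihilate Q b, which gives the second bound.

    In the second part, call a subspace a graph of slope t over range Q if
    |(1 - Q) w| <= t |Q w| for each of its vectors w and Q maps it onto range Q.
    The distance nu / sqrt (1 + nu^2) is the sine of the angle of tangent nu, so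
    range R has slope nu over range Pi ([d2_slope]).  The matrix A stretches
    the Pi component by at least sigma_k and the complementary one by at most
    sigma_(k+1), and keeps them orthogonal ([svd_lead_le], [svd_trail_le]).
    Hence range (A R) has slope t = nu sigma_(k+1) / sigma_k over range Q, and a
    graph of slope t is at distance at most t from its base
    ([orthoproj_dist_le]).  Finally, the component of x = R z outside range Pi
    has norm at most nu |Pi x| <= (nu / sigma_k) |Q A x|, where
    |Q A x| = |Q P b| <= |b|; the stated bound is weaker because
    0 < sqrt (1 - nu^2) - nu <= 1. *)

(** * Inner product and Euclidean norm *)

Definition dot (F : realType) (m : nat) (x y : 'cV[F]_m) : F :=
  (x^T *m y) 0 0.

Section Euclidean.
Variable F : realType.
Implicit Types (m n p : nat).

Lemma dot_sqrE m (x : 'cV[F]_m) : dot x x = \sum_i x i 0 ^+ 2.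
Proof. by rewrite /dot mxE; apply: eq_bigr => i _; rewrite mxE expr2. Qed.

Lemma dotC m (x y : 'cV[F]_m) : dot x y = dot y x.
Proof. by rewrite /dot -[x^T *m y]trmxK mxE trmx_mul trmxK. Qed.

Lemma dotDr m (x y z : 'cV[F]_m) : dot x (y + z) = dot x y + dot x z.
Proof. by rewrite /dot mulmxDr mxE. Qed.

Lemma dotDl m (x y z : 'cV[F]_m) : dot (x + y) z = dot x z + dot y z.
Proof. by rewrite dotC dotDr !(dotC z). Qed.

Lemma dotZr m a (x y : 'cV[F]_m) : dot x (a *: y) = a * dot x y.
Proof. by rewrite /dot -scalemxAr mxE. Qed.

Lemma dotZl m a (x y : 'cV[F]_m) : dot (a *: x) y = a * dot x y.
Proof. by rewrite dotC dotZr dotC. Qed.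

Lemma dotNr m (x y : 'cV[F]_m) : dot x (- y) = - dot x y.
Proof. by rewrite -scaleN1r dotZr mulN1r. Qed.

Lemma dotNl m (x y : 'cV[F]_m) : dot (- x) y = - dot x y.
Proof. by rewrite dotC dotNr dotC. Qed.

Lemma dot_mull m n (M : 'M[F]_(m, n)) x y : dot (M *m x) y = dot x (M^T *m y).
Proof. by rewrite /dot trmx_mul mulmxA. Qed.

Lemma dot_ge0 m (x : 'cV[F]_m) : 0 <= dot x x.
Proof. by rewrite dot_sqrE sumr_ge0 // => i _; rewrite sqr_ge0. Qed.

Lemma dot_eq0 m (x : 'cV[F]_m) : dot x x = 0 -> x = 0.
Proof.
rewrite dot_sqrE => /eqP; rewrite psumr_eq0 => [|i _]; last exact: sqr_ge0.
move=> /allP h; apply/colP => i; rewrite mxE.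
by apply/eqP; rewrite -sqrf_eq0; apply: h; rewrite mem_index_enum.
Qed.

Lemma l2norm_ge0 m (x : 'cV[F]_m) : 0 <= l2norm x.
Proof. exact: sqrtr_ge0. Qed.

Lemma sqr_l2norm m (x : 'cV[F]_m) : l2norm x ^+ 2 = dot x x.
Proof. by rewrite /l2norm -dot_sqrE sqr_sqrtr // dot_ge0. Qed.

Lemma l2norm_eq0 m (x : 'cV[F]_m) : l2norm x = 0 -> x = 0.
Proof. by move=> x0; apply: dot_eq0; rewrite -sqr_l2norm x0 expr0n. Qed.

Lemma l2norm0 m : l2norm (0 : 'cV[F]_m) = 0.
Proof. by rewrite /l2norm big1 ?sqrtr0 // => i _; rewrite mxE expr0n. Qed.

Lemma l2norm_le m n (x : 'cV[F]_m) (y : 'cV[F]_n) :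
  dot x x <= dot y y -> l2norm x <= l2norm y.
Proof. by move=> ?; rewrite /l2norm -!dot_sqrE ler_wsqrtr. Qed.

Lemma l2norm_leM m n a (x : 'cV[F]_m) (y : 'cV[F]_n) :
  0 <= a -> dot x x <= a ^+ 2 * dot y y -> l2norm x <= a * l2norm y.
Proof.
move=> a0 h; rewrite -(@ler_pXn2r _ 2) ?nnegrE ?mulr_ge0 ?l2norm_ge0 //.
by rewrite exprMn !sqr_l2norm.
Qed.

Lemma l2normZ m a (x : 'cV[F]_m) : l2norm (a *: x) = `|a| * l2norm x.
Proof.
rewrite /l2norm -!dot_sqrE dotZl dotZr mulrA -expr2 sqrtrM ?sqr_ge0 //.
by rewrite sqrtr_sqr.
Qed.

Lemma l2normN m (x : 'cV[F]_m) : l2norm (- x) = l2norm x.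
Proof. by rewrite -scaleN1r l2normZ normrN1 mul1r. Qed.

(** The squared length of <y, y> x - <x, y> y is <y, y> times the difference of
    the two sides. *)
Lemma cauchy_schwarz_sqr m (x y : 'cV[F]_m) :
  dot x y ^+ 2 <= dot x x * dot y y.
Proof.
have [->|y0] := eqVneq y 0; first by rewrite /dot !mulmx0 !mxE expr0n mulr0.
have yy : 0 < dot y y.
  rewrite lt_def dot_ge0 andbT.
  by apply: contraNneq y0 => /dot_eq0 ->; exact: eqxx.
rewrite -subr_ge0 -(pmulr_rge0 _ yy).
have := dot_ge0 (dot y y *: x - dot x y *: y).
rewrite !(dotDl, dotDr, dotNl, dotNr, dotZl, dotZr) (dotC y x).
by congr (_ <= _); ring.
Qed.

Lemma cauchy_schwarz m (x y : 'cV[F]_m) : dot x y <= l2norm x * l2norm y.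
Proof.
have [xy|/ltW xy] := lerP (dot x y) 0.
  by rewrite (le_trans xy) // mulr_ge0 // l2norm_ge0.
rewrite -(@ler_pXn2r _ 2) ?nnegrE ?mulr_ge0 ?l2norm_ge0 //.
by rewrite exprMn !sqr_l2norm cauchy_schwarz_sqr.
Qed.

Lemma l2normD m (x y : 'cV[F]_m) : l2norm (x + y) <= l2norm x + l2norm y.
Proof.
rewrite -(@ler_pXn2r _ 2) ?nnegrE ?addr_ge0 ?l2norm_ge0 //.
rewrite sqrrD !sqr_l2norm dotDl !dotDr (dotC y x).
by have := cauchy_schwarz x y; lra.
Qed.

Lemma l2norm_dist m (x y : 'cV[F]_m) :
  `|l2norm x - l2norm y| <= l2norm (x - y).
Proof.
rewrite ler_norml.
have := l2normD (x - y) y; have := l2normD (- (x - y)) x.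
rewrite subrK l2normN opprB subrK => h1 h2.
by apply/andP; split; lra.
Qed.

(** * Spectral norm *)

(** A supremum is an upper bound only for a bounded set; the Frobenius norm
    bounds the one that defines the spectral norm. *)
Lemma l2norm_mul_bounded m n (M : 'M[F]_(m, n)) (x : 'cV[F]_n) :
  l2norm (M *m x) <=
  Num.sqrt (\sum_i l2norm (row i M)^T ^+ 2) * l2norm x.
Proof.
apply: l2norm_leM; first exact: sqrtr_ge0.
rewrite sqr_sqrtr; last by apply: sumr_ge0 => i _; exact: sqr_ge0.
rewrite dot_sqrE mulr_suml; apply: ler_sum => i _.
have -> : (M *m x) i 0 = dot (row i M)^T x.
  by rewrite /dot trmxK -row_mul [RHS]mxE.
by rewrite sqr_l2norm cauchy_schwarz_sqr.
Qed.

Lemma l2norm_mul_le m n (M : 'M[F]_(m, n)) (x : 'cV[F]_n) :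
  l2norm (M *m x) <= specnorm M * l2norm x.
Proof.
have [->|x0] := eqVneq x 0; first by rewrite mulmx0 !l2norm0 mulr0.
have nx : 0 < l2norm x.
  rewrite lt_def l2norm_ge0 andbT.
  by apply: contraNneq x0 => /l2norm_eq0 ->; exact: eqxx.
rewrite -ler_pdivrMr // mulrC -[X in X * _]ger0_norm ?invr_ge0 ?l2norm_ge0 //.
rewrite -l2normZ scalemxAr; apply: ub_le_sup.
  exists (Num.sqrt (\sum_i l2norm (row i M)^T ^+ 2)) => _ [y /= y1 <-].
  apply: le_trans (l2norm_mul_bounded M y) _.
  by rewrite -[leRHS]mulr1 ler_wpM2l ?sqrtr_ge0.
exists ((l2norm x)^-1 *: x) => //=.
by rewrite l2normZ ger0_norm ?invr_ge0 ?l2norm_ge0 // mulVf // gt_eqF.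
Qed.

(** * Orthogonal projections *)

Definition orthoproj m (P : 'M[F]_m) : Prop := P^T = P /\ P *m P = P.

Lemma orthoproj_gram m p (W : 'M[F]_(m, p)) :
  W^T *m W = 1%:M -> orthoproj (W *m W^T).
Proof.
by move=> W1; split; rewrite ?trmx_mul ?trmxK // mulmxA -(mulmxA W) W1 mulmx1.
Qed.

Lemma orthoproj_compl m (P : 'M[F]_m) : orthoproj P -> orthoproj (1%:M - P).
Proof.
case=> Pt PP; split; first by rewrite linearB /= trmx1 Pt.
by rewrite mulmxBl mul1mx mulmxBr mulmx1 PP subrr subr0.
Qed.

Lemma orthoproj_pythagoras m (P : 'M[F]_m) (x : 'cV[F]_m) : orthoproj P ->
  dot x x = dot (P *m x) (P *m x) + dot (x - P *m x) (x - P *m x).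
Proof.
case=> Pt PP.
have h : dot (P *m x) (P *m x) = dot x (P *m x).
  by rewrite dot_mull Pt mulmxA PP.
by rewrite !(dotDl, dotDr, dotNl, dotNr) (dotC (P *m x) x) h; ring.
Qed.

Lemma orthoproj_le m (P : 'M[F]_m) (x : 'cV[F]_m) :
  orthoproj P -> l2norm (P *m x) <= l2norm x.
Proof.
move=> oP; apply: l2norm_le.
by rewrite (orthoproj_pythagoras x oP) lerDl dot_ge0.
Qed.

Lemma dot_isometry m p (W : 'M[F]_(m, p)) (x : 'cV[F]_p) :
  W^T *m W = 1%:M -> dot (W *m x) (W *m x) = dot x x.
Proof. by move=> W1; rewrite dot_mull mulmxA W1 mul1mx. Qed.

Lemma l2norm_isometry m p (W : 'M[F]_(m, p)) (x : 'cV[F]_p) :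
  W^T *m W = 1%:M -> l2norm (W *m x) = l2norm x.
Proof. by move=> W1; rewrite /l2norm -!dot_sqrE dot_isometry. Qed.

Lemma l2norm_tr_isometry m p (W : 'M[F]_(m, p)) (x : 'cV[F]_m) :
  W^T *m W = 1%:M -> l2norm (W^T *m x) <= l2norm x.
Proof.
move=> W1; rewrite -(l2norm_isometry (W^T *m x) W1) mulmxA.
by apply: orthoproj_le; apply: orthoproj_gram.
Qed.

(** The projection along a complement is pinned down by its values on the two
    summands, and W W^T is the identity on the range of W and zero on its
    orthogonal complement. *)
Lemma col_proj_isometry m p (W : 'M[F]_(m, p)) :
  W^T *m W = 1%:M -> col_proj W = W *m W^T.
Proof.
move=> W1; have [WWt _] := orthoproj_gram W1.
have trivI : (<<W^T>> :&: kermx W = 0)%MS.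
  apply/eqP/rowV0P => v; rewrite sub_capmx genmxE => /andP[/submxP[w ->]].
  by move/sub_kermxP; rewrite -mulmxA W1 mulmx1 => ->; rewrite mul0mx.
rewrite /col_proj -[RHS]WWt; congr trmx.
rewrite -[LHS]mul1mx -[X in X *m proj_mx _ _](subrK (W *m W^T)) mulmxDl.
rewrite proj_mx_0 // ?add0r ?proj_mx_id ?genmxE ?submxMl //.
by apply/sub_kermxP; rewrite mulmxBl mul1mx -mulmxA W1 mulmx1 subrr.
Qed.

(** A graph of slope t over the range of Q is within distance t of that range.
    The vector P c - Q c is the orthogonal sum of P (c - Q c) and
    P (Q c) - Q c.  The slope bounds (1 - Q) P by t, hence also its adjoint
    P (1 - Q), which controls the first term.  For the second one, Q c = Q w
    for some w in the graph, and the distance from Q c to the graph is at most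
    its distance |w - Q w| to w.  Adding the squares, c - Q c and Q c are again
    orthogonal, which gives t rather than 2 t. *)
Lemma orthoproj_dist_le m (P Q : 'M[F]_m) (t : F) :
  orthoproj P -> orthoproj Q -> 0 <= t ->
  (forall w : 'cV_m,
     l2norm (P *m w - Q *m (P *m w)) <= t * l2norm (Q *m (P *m w))) ->
  (forall c : 'cV_m, exists w, Q *m (P *m w) = Q *m c) ->
  forall c : 'cV_m, l2norm (P *m c - Q *m c) <= t * l2norm c.
Proof.
move=> oP oQ t0 slope onto c.
have [Pt PP] := oP; have [Qt QQ] := oQ.
have defect_Q (e : 'cV_m) :
    l2norm (Q *m e - P *m (Q *m e)) <= t * l2norm (Q *m e).
  have [w Qw] := onto e.
  apply: (@le_trans _ _ (l2norm (Q *m e - P *m w))); last first.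
    by rewrite -l2normN opprB -Qw slope.
  have -> : Q *m e - P *m (Q *m e) = (1%:M - P) *m (Q *m e - P *m w).
    by rewrite mulmxBl !mul1mx mulmxBr !(mulmxA P P) PP opprB addrA subrK.
  exact/orthoproj_le/orthoproj_compl.
have P_defect (e : 'cV_m) :
    l2norm (P *m (e - Q *m e)) <= t * l2norm (e - Q *m e).
  set f := e - Q *m e; set g := P *m f.
  have Qf : f = (1%:M - Q) *m f.
    by rewrite /f mulmxBl !mul1mx mulmxBr (mulmxA Q Q) QQ subrr subr0.
  (* |P f|^2 = <P f, f> = <(1 - Q) P f, f> <= t |P f| |f|. *)
  have gle : l2norm (g - Q *m g) <= t * l2norm g.
    apply: le_trans (slope f) _; rewrite ler_wpM2l //.
    exact: orthoproj_le.
  have [g0|g0] := eqVneq (l2norm g) 0; first by rewrite g0 mulr_ge0 ?l2norm_ge0.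
  have gp : 0 < l2norm g by rewrite lt_def g0 l2norm_ge0.
  rewrite -(ler_pM2l gp) -expr2 sqr_l2norm mulrCA mulrA.
  have -> : dot g g = dot (g - Q *m g) f.
    have -> : dot g g = dot f g by rewrite {1}/g dot_mull Pt mulmxA PP.
    rewrite {1}Qf dot_mull dotC; case: (orthoproj_compl oQ) => -> _.
    by rewrite mulmxBl mul1mx.
  apply: le_trans (cauchy_schwarz _ _) _.
  by rewrite ler_wpM2r ?l2norm_ge0.
apply: l2norm_leM => //.
rewrite (orthoproj_pythagoras _ oP) (orthoproj_pythagoras c oQ) mulrDr addrC.
have sq (x : 'cV[F]_m) (y : 'cV[F]_m) :
    l2norm x <= t * l2norm y -> dot x x <= t ^+ 2 * dot y y.
  by rewrite -!sqr_l2norm -exprMn ler_pXn2r ?nnegrE ?mulr_ge0 ?l2norm_ge0.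
apply: lerD.
  apply: sq; rewrite mulmxBr (mulmxA P P) PP opprB addrC subrKA -l2normN opprB.
  exact: defect_Q.
apply: sq; rewrite mulmxBr (mulmxA P P) PP -mulmxBr; exact: P_defect.
Qed.

Lemma unitmx_injective p (G : 'M[F]_p) :
  (forall z : 'cV_p, G *m z = 0 -> z = 0) -> G \in unitmx.
Proof.
move=> inj; rewrite -unitmx_tr -row_free_unit -kermx_eq0.
apply/rowV0P => v /sub_kermxP vG; apply: trmx_inj.
by rewrite trmx0; apply: inj; rewrite -[G]trmxK -trmx_mul vG trmx0.
Qed.

(** * Moore-Penrose inverse of an injective matrix *)

(** The Penrose equations are solved explicitly by (X^T X)^-1 X^T. *)
Lemma mp_inverseP m p (X : 'M[F]_(m, p)) :
  (forall z : 'cV_p, X *m z = 0 -> z = 0) -> is_mp_inverse X (mp_inverse X).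
Proof.
move=> inj; apply: xgetPex; pose G := X^T *m X.
have Gu : G \in unitmx.
  apply: unitmx_injective => z Gz; apply/inj/dot_eq0.
  by rewrite dot_mull mulmxA Gz /dot mulmx0 mxE.
have Gt : G^T = G by rewrite trmx_mul trmxK.
have YX : invmx G *m X^T *m X = 1%:M by rewrite -mulmxA mulVmx.
exists (invmx G *m X^T); split; rewrite ?YX ?mul1mx ?trmx1 //.
  by rewrite -mulmxA YX mulmx1.
by rewrite !trmx_mul trmxK trmx_inv Gt mulmxA.
Qed.

Lemma orthoproj_mp m p (X : 'M[F]_(m, p)) (Y : 'M[F]_(p, m)) :
  is_mp_inverse X Y -> orthoproj (X *m Y).
Proof. by case=> h1 h2 h3 _; split; rewrite // mulmxA h1. Qed.

(** X X^+ depends only on the range of X, here the range of W. *)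
Lemma mp_range_proj m p (W : 'M[F]_(m, p)) (T : 'M[F]_p) :
  W^T *m W = 1%:M -> T \in unitmx ->
  W *m T *m mp_inverse (W *m T) = W *m W^T.
Proof.
move=> W1 Tu.
have : is_mp_inverse (W *m T) (mp_inverse (W *m T)).
  apply: mp_inverseP => z /(congr1 (mulmx (invmx T *m W^T))).
  by rewrite mulmx0 !mulmxA -(mulmxA (invmx T)) W1 mulmx1 mulVmx // mul1mx.
set Y := mp_inverse _ => -[XYX _ XYt _].
have PW : W *m T *m Y *m W = W.
  by rewrite -[X in _ *m X](mulmxK Tu) mulmxA XYX mulmxK.
have Wt : W^T = W^T *m (W *m T *m Y) by rewrite -{1}PW trmx_mul XYt.
by rewrite [X in _ = _ *m X]Wt !mulmxA -(mulmxA W W^T) W1 mulmx1.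
Qed.

(** * Leading and trailing singular directions *)

(** Selecting columns of M is multiplication on the right by the corresponding
    columns of the identity matrix, so that associativity and the gram
    identities below replace computations on entries. *)
Definition lead_mx r k : 'M[F]_(r, k) := \matrix_(i, j) (i == j :> nat)%:R.
Definition trail_mx r k : 'M[F]_(r, r - k) :=
  \matrix_(i, j) (i == (k + j)%N :> nat)%:R.

Lemma lead_mxE r k i j : lead_mx r k i j = (i == j :> nat)%:R.
Proof. by rewrite mxE. Qed.

Lemma trail_mxE r k i j : trail_mx r k i j = (i == (k + j)%N :> nat)%:R.
Proof. by rewrite mxE. Qed.

Lemma first_colsE m r k (M : 'M[F]_(m, r)) : first_cols k M = M *m lead_mx r k.
Proof.
apply/matrixP => i j; rewrite !mxE.
case: insubP => [l _ lj|jr]; rewrite /=.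
  rewrite (bigD1 l) //= lead_mxE lj eqxx mulr1 big1 ?addr0 // => p pl.
  rewrite lead_mxE -lj.
  by case: eqP => [/val_inj /eqP|_]; rewrite ?(negPf pl) // mulr0.
rewrite big1 // => p _; rewrite lead_mxE.
case: eqP => [pj|_]; last by rewrite mulr0.
by rewrite -pj ltn_ord in jr.
Qed.

Lemma last_colsE m r k (M : 'M[F]_(m, r)) : last_cols k M = M *m trail_mx r k.
Proof.
apply/matrixP => i j; rewrite !mxE.
case: insubP => [l _ lj|jr]; rewrite /=.
  rewrite (bigD1 l) //= trail_mxE lj eqxx mulr1 big1 ?addr0 // => p pl.
  rewrite trail_mxE -lj.
  by case: eqP => [/val_inj /eqP|_]; rewrite ?(negPf pl) // mulr0.
rewrite big1 // => p _; rewrite trail_mxE.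
case: eqP => [pj|_]; last by rewrite mulr0.
by rewrite -pj ltn_ord in jr.
Qed.

Lemma lead_gram r k : (k <= r)%N -> (lead_mx r k)^T *m lead_mx r k = 1%:M.
Proof.
move=> kr; apply/matrixP => i j; rewrite !mxE.
rewrite (bigD1 (widen_ord kr i)) //= mxE !lead_mxE /= eqxx mul1r big1 ?addr0 //.
move=> p pi; rewrite mxE lead_mxE; case: eqP => [e|_]; last by rewrite mul0r.
by case/eqP: pi; apply: val_inj.
Qed.

Lemma trail_gram r k : (trail_mx r k)^T *m trail_mx r k = 1%:M.
Proof.
apply/matrixP => i j; rewrite !mxE.
have kir : (k + i < r)%N by have := ltn_ord i; rewrite ltn_subRL.
rewrite (bigD1 (Ordinal kir)) //= mxE !trail_mxE /= eqxx mul1r eqn_add2l.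
rewrite big1 ?addr0 // => p pi.
rewrite mxE trail_mxE; case: eqP => [e|_]; last by rewrite mul0r.
by case/eqP: pi; apply: val_inj.
Qed.

Lemma trail_lead r k : (trail_mx r k)^T *m lead_mx r k = 0.
Proof.
apply/matrixP => i j; rewrite !mxE big1 // => p _.
rewrite mxE trail_mxE lead_mxE; case: eqP => [->|_]; last by rewrite mul0r.
by rewrite gtn_eqF ?mulr0 // ltn_addr.
Qed.

Lemma lead_proj r k :
  lead_mx r k *m (lead_mx r k)^T = diag_mx (\row_i (i < k)%N%:R).
Proof.
apply/matrixP => i j; rewrite !mxE; have [ik|ki] := ltnP i k.
  rewrite (bigD1 (Ordinal ik)) //= lead_mxE mxE lead_mxE eqxx mul1r.
  rewrite big1 ?addr0 => [|p pi].
    by rewrite eq_sym -val_eqE.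
  rewrite lead_mxE; case: eqP => [e|_]; last by rewrite mul0r.
  by case/eqP: pi; apply: val_inj.
rewrite mul0rn big1 // => p _; rewrite lead_mxE gtn_eqF ?mul0r //.
exact: leq_trans (ltn_ord p) ki.
Qed.

Lemma lead_projE r k (y : 'cV[F]_r) i :
  (lead_mx r k *m (lead_mx r k)^T *m y) i 0 = (i < k)%N%:R * y i 0.
Proof. by rewrite lead_proj mul_diag_mx !mxE. Qed.

Lemma lead_diagC r k (S : 'rV[F]_r) :
  lead_mx r k *m (lead_mx r k)^T *m diag_mx S =
  diag_mx S *m (lead_mx r k *m (lead_mx r k)^T).
Proof. by rewrite lead_proj diag_mxC. Qed.

Lemma diag_mulE r (S : 'rV[F]_r) (y : 'cV[F]_r) i :
  (diag_mx S *m y) i 0 = S 0 i * y i 0.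
Proof. by rewrite mul_diag_mx mxE. Qed.

Lemma sigma_lead r k (S : 'rV[F]_r) (i : 'I_r) :
  (forall i j : 'I_r, (i <= j)%N -> S 0 j <= S 0 i) -> (forall i, 0 <= S 0 i) ->
  (i < k)%N -> sigma S k <= S 0 i.
Proof.
move=> mono nn ik; rewrite /sigma; case: insubP => [l _ lk|_] //=; apply: mono.
by rewrite lk -ltnS prednK //; apply: leq_trans ik.
Qed.

Lemma sigma_trail r k (S : 'rV[F]_r) (i : 'I_r) :
  (forall i j : 'I_r, (i <= j)%N -> S 0 j <= S 0 i) ->
  (k <= i)%N -> S 0 i <= sigma S k.+1.
Proof.
move=> mono ki; rewrite /sigma /=.
case: insubP => [l _ lk|]; first by apply: mono; rewrite lk.
by rewrite (leq_ltn_trans ki).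
Qed.

Lemma sigma_ge0 r k (S : 'rV[F]_r) : (forall i, 0 <= S 0 i) -> 0 <= sigma S k.
Proof. by move=> nn; rewrite /sigma; case: insub => /=. Qed.

Lemma sigma_gt0_le r k (S : 'rV[F]_r) :
  (0 < k)%N -> 0 < sigma S k -> (k <= r)%N.
Proof.
rewrite /sigma; case: insubP => [l lr lk|]; last by rewrite ltxx.
by case: k lr lk.
Qed.

Section FirstLastCols.
Variables (p r k : nat) (W : 'M[F]_(p, r)).
Hypothesis W1 : W^T *m W = 1%:M.

Lemma first_cols_gram : (k <= r)%N ->
  (first_cols k W)^T *m first_cols k W = 1%:M.
Proof.
move=> kr; rewrite !first_colsE trmx_mul mulmxA -(mulmxA _ W^T) W1 mulmx1.
exact: lead_gram.
Qed.

Lemma last_cols_gram : (last_cols k W)^T *m last_cols k W = 1%:M.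
Proof.
rewrite !last_colsE trmx_mul mulmxA -(mulmxA _ W^T) W1 mulmx1.
exact: trail_gram.
Qed.

Lemma last_first_cols : (last_cols k W)^T *m first_cols k W = 0.
Proof.
rewrite last_colsE first_colsE trmx_mul mulmxA -(mulmxA _ W^T) W1 mulmx1.
exact: trail_lead.
Qed.

(** The trailing columns do not see the range of the leading ones, so any
    vector of that range may be subtracted before applying the contraction. *)
Lemma last_cols_le (x : 'cV[F]_p) (y : 'cV[F]_k) :
  l2norm ((last_cols k W)^T *m x) <= l2norm (x - first_cols k W *m y).
Proof.
have -> : (last_cols k W)^T *m x =
    (last_cols k W)^T *m (x - first_cols k W *m y).
  by rewrite mulmxBr (mulmxA _ _ y) last_first_cols mul0mx subr0.
exact/l2norm_tr_isometry/last_cols_gram.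
Qed.

End FirstLastCols.

(** * A matrix acting between its leading singular subspaces *)

Section Svd.
Variables (m n : nat) (X : 'M[F]_(m, n)) (U : 'M[F]_(m, minn m n)).
Variables (S : 'rV[F]_(minn m n)) (V : 'M[F]_(n, minn m n)).
Hypothesis svdX : is_thin_svd X U S V.
Variable k : nat.
Notation E := (lead_mx (minn m n) k).

(** If sigma_k = 0, all the later singular values vanish too, and X factors
    through the first k - 1 singular directions. *)
Lemma svd_rank_sigma : (0 < k)%N -> (k <= \rank X)%N -> 0 < sigma S k.
Proof.
case: svdX => _ _ XE mono nn k0 kX; rewrite lt_def sigma_ge0 // andbT.
apply: contraTneq kX => S0; rewrite -ltnNge.
case: k k0 S0 => // k' _ S0; rewrite ltnS XE.
have -> : diag_mx S =
    lead_mx (minn m n) k' *m (lead_mx (minn m n) k')^T *m diag_mx S.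
  rewrite lead_proj; apply/matrixP => i j; rewrite mul_diag_mx !mxE.
  have [_|ki] := ltnP i k'; first by rewrite mul1r.
  rewrite mul0r; have -> : S 0 i = 0; last by rewrite mul0rn.
  by apply/le_anti; rewrite nn -S0 sigma_trail.
rewrite -!mulmxA mulmxA.
exact: leq_trans (mxrankM_maxl _ _) (rank_leq_col _).
Qed.

Notation Uk := (first_cols k U).
Notation Vk := (first_cols k V).

(** In the singular bases X acts diagonally, by factors at least sigma_k on the
    first k coordinates; the projection onto the first k left singular vectors
    selects the image of these coordinates. *)
Lemma svd_lead_le (x : 'cV[F]_n) :
  sigma S k * l2norm (Vk *m Vk^T *m x) <= l2norm (Uk *m Uk^T *m (X *m x)).
Proof.
case: svdX => U1 V1 XE mono nn; rewrite !first_colsE !trmx_mul.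
set y := V^T *m x.
have -> : V *m E *m (E^T *m V^T) *m x = V *m (E *m E^T *m y) by rewrite !mulmxA.
have -> : U *m E *m (E^T *m U^T) *m (X *m x) =
          U *m (diag_mx S *m (E *m E^T *m y)).
  rewrite (mulmxA (diag_mx S)) -lead_diagC XE !mulmxA.
  by rewrite -(mulmxA _ U^T U) U1 mulmx1.
rewrite (l2norm_isometry _ V1) (l2norm_isometry _ U1); set e := _ *m y.
rewrite -[sigma S k]ger0_norm ?sigma_ge0 // -l2normZ; apply: l2norm_le.
rewrite !dot_sqrE; apply: ler_sum => i _.
rewrite diag_mulE [X in X ^+ 2 <= _]mxE lead_projE; have [ik|_] := ltnP i k.
  rewrite mul1r !exprMn ler_wpM2r ?sqr_ge0 // ler_sqr ?nnegrE ?sigma_ge0 //.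
  exact: sigma_lead.
by rewrite mul0r !mulr0.
Qed.

(** The complementary coordinates are stretched by at most sigma_(k+1).  What x
    has outside the span of all the right singular vectors is lost in X x and
    only makes the right-hand side larger. *)
Lemma svd_trail_le (x : 'cV[F]_n) :
  l2norm (X *m x - Uk *m Uk^T *m (X *m x)) <=
  sigma S k.+1 * l2norm (x - Vk *m Vk^T *m x).
Proof.
case: svdX => U1 V1 XE mono nn; rewrite !first_colsE !trmx_mul.
set y := V^T *m x; set P := V *m E *m _ *m x.
have -> : X *m x - U *m E *m (E^T *m U^T) *m (X *m x) =
          U *m (diag_mx S *m (y - E *m E^T *m y)).
  rewrite !mulmxBr (mulmxA (diag_mx S) (_ *m _)) -lead_diagC XE !mulmxA.
  by rewrite -(mulmxA _ U^T U) U1 mulmx1.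
have yE : y - E *m E^T *m y = V^T *m (x - P).
  by rewrite mulmxBr /P !mulmxA V1 mul1mx.
rewrite (l2norm_isometry _ U1).
apply: le_trans (ler_wpM2l (sigma_ge0 k.+1 nn) (l2norm_tr_isometry (x - P) V1)).
rewrite -yE -[sigma S _]ger0_norm ?sigma_ge0 // -l2normZ; apply: l2norm_le.
rewrite !dot_sqrE; apply: ler_sum => i _.
rewrite diag_mulE [X in _ <= X ^+ 2]mxE.
have -> : (y - E *m E^T *m y) i 0 = (k <= i)%N%:R * y i 0 :> F.
  rewrite mxE [X in _ + X]mxE lead_projE ltnNge.
  by case: (k <= i)%N; rewrite ?mul0r ?mul1r ?oppr0 ?subr0 ?subrr ?addr0.
have [ki|_] := leqP k i; last by rewrite mul0r !mulr0.
rewrite mul1r !exprMn ler_wpM2r ?sqr_ge0 // ler_sqr ?nnegrE ?sigma_ge0 //.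
exact: sigma_trail.
Qed.

Hypothesis k_gt0 : (0 < k)%N.
Hypothesis sk_gt0 : 0 < sigma S k.

(** X sends the span of the first k right singular vectors bijectively to the
    span of the first k left ones: the regression in [is_pcr] is unconstrained
    within the latter, and the pseudo-inverse of X V_k yields the projection
    onto it. *)
Lemma svd_lead_unit : exists2 T : 'M_k, T \in unitmx & X *m Vk = Uk *m T.
Proof.
have kr := sigma_gt0_le k_gt0 sk_gt0.
case: (svdX) => U1 V1 XE _ _.
have Uk1 := first_cols_gram U1 kr; have Vk1 := first_cols_gram V1 kr.
pose T := E^T *m diag_mx S *m E.
have XV : X *m Vk = Uk *m T.
  rewrite !first_colsE XE mulmxA -(mulmxA _ V^T) V1 mulmx1 /T -!mulmxA.
  congr (U *m _).
  by rewrite !mulmxA lead_diagC -!mulmxA lead_gram // mulmx1.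
exists T => //; apply: unitmx_injective => z Tz.
have := svd_lead_le (Vk *m z).
rewrite (mulmxA X) XV -(mulmxA Uk T) Tz !mulmx0 l2norm0.
rewrite -(mulmxA Vk) (mulmxA Vk^T) Vk1 mul1mx.
rewrite l2norm_isometry // pmulr_rle0 // => z0.
by apply/l2norm_eq0/le_anti; rewrite z0 l2norm_ge0.
Qed.

(** The fitted values range over the span of the first k left singular vectors
    of X, where the closest point to b is its orthogonal projection. *)
Lemma pcr_residual (b : 'cV[F]_m) :
  l2norm (X *m pcr X V b k - b) = l2norm (Uk *m Uk^T *m b - b).
Proof.
have kr := sigma_gt0_le k_gt0 sk_gt0.
case: (svdX) => U1 _ _ _ _.
have Uk1 := first_cols_gram U1 kr.
have [T Tu XV] := svd_lead_unit.
pose y0 := invmx T *m (Uk^T *m b).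
have Xy0 : X *m (Vk *m y0) = Uk *m Uk^T *m b.
  by rewrite mulmxA XV /y0 -mulmxA mulKVmx // mulmxA.
have min (y : 'cV_k) :
    l2norm (Uk *m Uk^T *m b - b) <= l2norm (X *m (Vk *m y) - b).
  have Qp := orthoproj_gram Uk1.
  rewrite (mulmxA X) XV -(mulmxA Uk T); set w := T *m y.
  have -> : Uk *m Uk^T *m b - b = (1%:M - Uk *m Uk^T) *m (Uk *m w - b).
    rewrite mulmxBr !mulmxBl !mul1mx -(mulmxA _ _ (Uk *m w)) (mulmxA Uk^T).
    by rewrite Uk1 mul1mx subrr sub0r opprB.
  exact/orthoproj_le/orthoproj_compl.
have [[y xy] xmin] : is_pcr X V b k (pcr X V b k).
  apply: xgetPex; exists (Vk *m y0); split; first by exists y0.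
  by move=> y; rewrite Xy0 min.
apply/le_anti; rewrite -{1}Xy0 xmin /= xy; exact: min.
Qed.

End Svd.

(** * Approximation bounds *)

(** The reverse triangle inequality. *)
Lemma projection_residual_dist m (P Q : 'M[F]_m) (b : 'cV[F]_m) :
  `|l2norm (P *m b - b) - l2norm (Q *m b - b)| <= l2norm (P *m b - Q *m b).
Proof.
by apply: le_trans (l2norm_dist _ _) _; rewrite opprB addrA subrK.
Qed.

(** For x = R z the hypothesis reads |x - W W^T x| <= sin a |x| with
    tan a = nu, and Pythagoras turns the sine into a tangent. *)
Lemma d2_slope m p q (R : 'M[F]_(m, p)) (W : 'M[F]_(m, q)) (nu : F) z :
  R^T *m R = 1%:M -> W^T *m W = 1%:M -> 0 <= nu ->
  d2 R W <= nu / Num.sqrt (1 + nu ^+ 2) ->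
  l2norm (R *m z - W *m W^T *m (R *m z)) <=
  nu * l2norm (W *m W^T *m (R *m z)).
Proof.
move=> R1 W1 nu0; rewrite /d2 !col_proj_isometry // => dle.
have oW := orthoproj_gram W1.
set x := R *m z; have c0 : 0 < 1 + nu ^+ 2 by rewrite ltr_pwDl ?sqr_ge0.
apply: l2norm_leM => //.
have : l2norm (x - W *m W^T *m x) <= nu / Num.sqrt (1 + nu ^+ 2) * l2norm x.
  apply: le_trans (ler_wpM2r (l2norm_ge0 x) dle).
  apply: le_trans (l2norm_mul_le _ _).
  by rewrite mulmxBl [in leRHS]/x -(mulmxA R) (mulmxA R^T) R1 mul1mx -/x lexx.
rewrite -(@ler_pXn2r _ 2) ?nnegrE ?mulr_ge0 ?invr_ge0 ?sqrtr_ge0 ?l2norm_ge0 //.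
rewrite !exprMn !sqr_l2norm exprVn (sqr_sqrtr (ltW c0)).
rewrite (orthoproj_pythagoras x oW) mulrAC ler_pdivlMr //.
by set p2 := dot (_ *m x) _; set r2 := dot _ _; lra.
Qed.

End Euclidean.

Theorem theorem5 (F : realType) (n d s k : nat)
    (A : 'M[F]_(n, d)) (b : 'cV[F]_n) (R : 'M[F]_(d, s)) (nu : F)
    (U : 'M[F]_(n, minn n d)) (S : 'rV[F]_(minn n d))
    (V : 'M[F]_(d, minn n d))
    (svdA : is_thin_svd A U S V)
    (k_ge1 : (1 <= k)%N) (k_le_rank : (k <= \rank A)%N)
    (gap : sigma S k.+1 < sigma S k)
    (k_le_s : (k <= s)%N)
    (nu_gt0 : 0 < nu) (nu_lt1 : nu < 1) :
  (forall (U' : 'M[F]_(n, minn n s)) (S' : 'rV[F]_(minn n s))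
          (V' : 'M[F]_(s, minn n s)),
     is_thin_svd (A *m R) U' S' V' ->
     (k <= \rank (A *m R))%N ->
     d2 (first_cols k U') (first_cols k U) <= nu ->
     approx_pcp A U V b k nu nu (A *m sketched_pcr A R V' b k)) /\
  (s = k ->
   R^T *m R = 1%:M ->
   d2 R (first_cols k V) <= nu / Num.sqrt (1 + nu ^+ 2) ->
   `|l2norm (A *m sketched_ls A R b - b) - l2norm (A *m pcr A V b k - b)|
     <= sigma S k.+1 / sigma S k * nu * l2norm b /\
   (0 < Num.sqrt (1 - nu ^+ 2) - nu ->
    approx_pcr A V b k
      (sigma S k.+1 / sigma S k * nu)
      (nu / ((Num.sqrt (1 - nu ^+ 2) - nu) * sigma S k))
      (sketched_ls A R b))).
Proof.
have [U1 V1 _ _ Snn] := svdA.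
have sk1_ge0 := sigma_ge0 k.+1 Snn.
have sk_gt0 : 0 < sigma S k := le_lt_trans sk1_ge0 gap.
have kr := sigma_gt0_le k_ge1 sk_gt0.
have Uk1 := first_cols_gram U1 kr; have Vk1 := first_cols_gram V1 kr.
split=> [U' S' V' svdAR kAR d2le|sk].
  have sk'_gt0 := svd_rank_sigma svdAR k_ge1 kAR.
  have [U'1 _ _ _ _] := svdAR.
  have U'k1 := first_cols_gram U'1 (sigma_gt0_le k_ge1 sk'_gt0).
  have [T Tu XV] := svd_lead_unit svdAR k_ge1 sk'_gt0.
  set Q := first_cols k U *m (first_cols k U)^T.
  set P := first_cols k U' *m (first_cols k U')^T.
  have Pb : A *m sketched_pcr A R V' b k = P *m b.
    by rewrite /sketched_pcr !mulmxA XV mp_range_proj.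
  have dist_le : l2norm (P *m b - Q *m b) <= nu * l2norm b.
    rewrite -mulmxBl; apply: le_trans (l2norm_mul_le _ _) _.
    rewrite ler_wpM2r ?l2norm_ge0 // /P /Q -(col_proj_isometry U'k1).
    by rewrite -(col_proj_isometry Uk1).
  split.
    rewrite /pcp (pcr_residual svdA) // Pb.
    exact: le_trans (projection_residual_dist _ _ _) dist_le.
  rewrite Pb; apply: le_trans dist_le.
  by rewrite /Q -mulmxA; exact: last_cols_le.
subst s => R1 d2le.
set Uk := first_cols k U; set Vk := first_cols k V; set Q := Uk *m Uk^T.
have slopeR (z : 'cV_k) := d2_slope z R1 Vk1 (ltW nu_gt0) d2le.
have lead_le (z : 'cV_k) :
    sigma S k * l2norm (Vk *m Vk^T *m (R *m z)) <= l2norm (Q *m (A *m R *m z)).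
  by rewrite -(mulmxA A); exact: (svd_lead_le svdA).
(* Neither restriction in range R -> range Pi -> range Q loses a vector: the
   first because the slope is finite, the second because sigma_k > 0. *)
have inj (z : 'cV_k) : Q *m (A *m R *m z) = 0 -> z = 0.
  move=> z0; have := lead_le z; rewrite z0 l2norm0 pmulr_rle0 // => Vz.
  have {}Vz : l2norm (Vk *m Vk^T *m (R *m z)) = 0.
    by apply/le_anti; rewrite Vz l2norm_ge0.
  have := slopeR z.
  rewrite Vz mulr0 (l2norm_eq0 Vz) subr0 l2norm_isometry // => h.
  by apply/l2norm_eq0/le_anti; rewrite h l2norm_ge0.
have mpAR : is_mp_inverse (A *m R) (mp_inverse (A *m R)).
  by apply: mp_inverseP => z z0; apply: inj; rewrite z0 mulmx0.
have oP := orthoproj_mp mpAR; have oQ : orthoproj Q := orthoproj_gram Uk1.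
set Y := mp_inverse (A *m R) in mpAR oP; set P := A *m R *m Y in oP.
have PAR : P *m (A *m R) = A *m R by case: mpAR.
pose t := sigma S k.+1 / sigma S k * nu.
have t_ge0 : 0 <= t by rewrite /t !mulr_ge0 // ?invr_ge0 // ltW.
have slope (z : 'cV_k) :
    l2norm (A *m R *m z - Q *m (A *m R *m z)) <=
    t * l2norm (Q *m (A *m R *m z)).
  rewrite -!(mulmxA A R); apply: le_trans (svd_trail_le svdA k _) _.
  apply: le_trans (ler_wpM2l sk1_ge0 (slopeR z)) _.
  have -> : t * l2norm (Q *m (A *m (R *m z))) = sigma S k.+1 *
      (nu * ((sigma S k)^-1 * l2norm (Q *m (A *m (R *m z))))).
    by rewrite /t; ring.
  rewrite ler_wpM2l // ler_wpM2l ?(ltW nu_gt0) // ler_pdivlMl //.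
  exact: (svd_lead_le svdA).
have dist_le (c : 'cV_n) : l2norm (P *m c - Q *m c) <= t * l2norm c.
  apply: orthoproj_dist_le => // [w|{}c].
    by have := slope (Y *m w); rewrite (mulmxA (A *m R)).
  (* The graph projects onto the whole of range Q: in coordinates this is a
     square matrix with trivial kernel. *)
  have Gu : Uk^T *m (A *m R) \in unitmx.
    apply: unitmx_injective => z Gz; apply: inj.
    by rewrite /Q -(mulmxA Uk) (mulmxA Uk^T) Gz mulmx0.
  exists (A *m R *m (invmx (Uk^T *m (A *m R)) *m (Uk^T *m c))).
  rewrite (mulmxA P) PAR /Q -!(mulmxA Uk); congr (_ *m _).
  by rewrite mulmxA mulKVmx.
have xE : sketched_ls A R b = R *m (Y *m b) by rewrite /sketched_ls mulmxA.
have Pb : A *m (R *m (Y *m b)) = P *m b by rewrite /P !mulmxA.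
have obj_le :
    `|l2norm (A *m sketched_ls A R b - b) - l2norm (A *m pcr A V b k - b)|
    <= sigma S k.+1 / sigma S k * nu * l2norm b.
  rewrite (pcr_residual svdA) // xE Pb.
  exact: le_trans (projection_residual_dist _ _ _) (dist_le b).
split=> // den_gt0; split=> //.
(* The bound nu / sigma_k, without the factor sqrt (1 - nu^2) - nu <= 1. *)
rewrite xE; apply: le_trans (last_cols_le V1 _ (Vk^T *m (R *m (Y *m b)))) _.
rewrite (mulmxA Vk); apply: le_trans (slopeR _) _.
apply: (@le_trans _ _ (nu / sigma S k * l2norm b)).
  rewrite -mulrA ler_wpM2l ?(ltW nu_gt0) // ler_pdivlMl //.
  apply: le_trans (lead_le _) _; rewrite (mulmxA (A *m R)).
  by apply: le_trans (orthoproj_le _ oQ) _; exact: orthoproj_le.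
rewrite ler_wpM2r ?l2norm_ge0 // ler_wpM2l ?(ltW nu_gt0) //.
rewrite lef_pV2 ?posrE ?mulr_gt0 // ger_pMl //.
have : Num.sqrt (1 - nu ^+ 2) <= 1.
  by rewrite -[leRHS]sqrtr1 ler_wsqrtr // gerBl sqr_ge0.
by move: nu_gt0; lra.
Qed.
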